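(* Every totally bounded paratopological group $G$ is countably cellular. Moreover, each cardinal of uncountable cofinality is a precaliber of $G$.
   Context: A paratopological group is a group $G$ with a topology making the group operation $G\times G\to G$ continuous (no separation axiom is assumed). $G$ is totally bounded if for any neighborhood $U$ of the unit of $G$ there is a finite subset $F\subset G$ with $G=F\cdot U$. A topological space is countably cellular if every family of pairwise disjoint nonempty open subsets is countable. A cardinal $\kappa$ is a precaliber of a topological space $X$ if any collection $\mathcal U$ of nonempty open subsets of $X$ with $|\mathcal U|=\kappa$ contains a centered subcollection $\mathcal V$ with $|\mathcal V|=\kappa$, where $\mathcal V$ is centered if $\bigcap\mathcal F\neq\emptyset$ for any finite subcollection $\mathcal F$ of $\mathcal V$. *)

(* Defs.v *)
From HB Require Import structures.
From mathcomp Require Import all_boot monoid.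
From mathcomp Require Import all_classical topology.
From mathcomp Require wochoice.

Set Implicit Arguments.
Unset Strict Implicit.
Unset Printing Implicit Defensive.

Local Open Scope classical_set_scope.
Local Open Scope card_scope.

HB.structure Definition PreTopologicalGroup := {G of Topological G & Group G}.

HB.mixin Record PreTopologicalGroup_isParatopological G
    of PreTopologicalGroup G := {
  mulg_continuous : continuous (fun xy : G * G => (xy.1 * xy.2)%g)
}.

#[short(type="paratopologicalGroupType")]
HB.structure Definition ParatopologicalGroup :=
  {G of PreTopologicalGroup G & PreTopologicalGroup_isParatopological G}.

Definition totally_bounded (G : paratopologicalGroupType) : Prop :=
  forall U : set G, nbhs (1%g : G) U ->
  exists2 F : set G, finite_set F &
    [set (f * u)%g | f in F & u in U] = [set: G].

Definition countably_cellular (X : topologicalType) : Prop :=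
  forall W : set (set X),
    (forall A, W A -> open A /\ A !=set0) -> trivIset W id -> countable W.

Definition centered (X : Type) (V : set (set X)) : Prop :=
  forall F : set (set X), finite_set F -> F `<=` V ->
    \bigcap_(A in F) A !=set0.

(* A cardinal is an initial ordinal: a type K with a (reflexive) well-order R
   all of whose proper initial segments {y | y < x} have cardinality strictly
   less than that of K.  Since R is total, y < x is written ~~ R x y. *)
Definition is_cardinal (K : Type) (R : rel K) : Prop :=
  wochoice.well_order R /\ forall x : K, ~~ ([set: K] #<= [set y | ~~ R x y]).

Definition cofinal (K : Type) (R : rel K) (C : set K) : Prop :=
  forall x : K, exists2 y, C y & R x y.

(* The cofinality is the least cardinality of a cofinal subset, so it is
   uncountable iff no cofinal subset is countable.  In particular a finite
   cardinal (cofinality 0 or 1) does not qualify. *)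
Definition uncountable_cofinality (K : Type) (R : rel K) : Prop :=
  forall C : set K, cofinal R C -> ~ countable C.

(* Only the cardinality of K matters here, not an order on it. *)
Definition precaliber (K : Type) (X : topologicalType) : Prop :=
  forall W : set (set X),
    (forall A, W A -> open A /\ A !=set0) -> W #= [set: K] ->
  exists V : set (set X), [/\ V `<=` W, V #= [set: K] & centered V].

(* Main.v *)
Require Import Defs.
From mathcomp Require Import all_boot monoid.
From mathcomp Require Import all_classical topology.
From mathcomp Require wochoice.

(** Let U_k, k in K, be nonempty open sets in a totally bounded paratopological
group G. Choose x_k in U_k and neighbourhoods V_(k,n) of the unit such that
x_k V_(k,0) is contained in U_k and V_(k,n+1) V_(k,n+1) in V_(k,n). For a set
A of indices, the finite intersections of the V_(k,n) with k in A generate a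
left-invariant topology T_A, coarser than that of G, and U_k may be shrunk to a
set open in T_{k}.

The decisive point is that every nonempty open set O is T_A-dense in some
nonempty T_A-open set, whatever A is ([finite_cover_dense], [dense_in_cell]).
Finitely many translates of O cover G, and a finite union of nowhere dense sets
is nowhere dense; as T_A is left-invariant, O is then somewhere dense. The
T_A-open set can moreover be taken among few ones, the cells: for each finite
t there are finitely many d such that G is covered by the sets d W^-1, where W
is the intersection of the V_(k,n) for (k,n) in t. Such a finite set of d
exists because total boundedness is a symmetric notion
([totally_bounded_inv]).

Well-order K. Each U_k is T_A-dense, for A the set of the indices below k, in
a cell Q_k that depends on finitely many indices below k. If K has regular
uncountable order type, pressing down ([pressing_down]) gives one cell Q that
serves for unboundedly many k. These U_k are centered
([homogeneous_meet]): inside Q, intersect them in increasing order of k; the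
intersection obtained so far is open for indices below the next k, so the next
U_k meets it. On the first uncountable ordinal this already forbids
uncountable disjoint families ([disjoint_family_countable]).

When K is a singular cardinal of uncountable cofinality, the argument is
applied to initial segments of successor cardinal length, which are regular
because an infinite cardinal equals its square ([card_square_below],
[regular_succ]). At each point c of a suitable closed unbounded set, it gives
many U_k with k between c and the successor of the cardinality of c, that are
centered over any set that is open for indices below c and contained in some
cell O_c ([homogeneous_chunk]). A reflection argument ([reflection]) makes
unboundedly many O_c depend only on indices below one fixed j, and the regular
case, applied on the cofinality of K, extracts a cofinal centered family of
O_c's. Going up through the chosen c's, the corresponding families of U_k
together form a centered family of full cardinality ([singular_centered]). *)

Set Implicit Arguments.
Unset Strict Implicit.
Unset Printing Implicit Defensive.

Local Open Scope classical_set_scope.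
Local Open Scope card_scope.

(** * Cardinalities *)

(** Relations are handier than functions here: they need no default value on
the elements outside A, and U may be empty. *)
Lemma card_le_relP T U (A : set T) (B : set U) :
  A #<= B <->
  exists r : T -> U -> Prop,
    (forall x, A x -> exists2 y, B y & r x y) /\
    (forall x x' y, A x -> A x' -> r x y -> r x' y -> x = x').
Proof.
split=> [/card_leP[f]|[r [rB rI]]].
  exists (fun x y => exists a : A, val a = x /\ val (f a) = y); split.
    move=> x Ax; exists (val (f (SigSub (mem_set Ax)))); first exact: set_valP.
    by exists (SigSub (mem_set Ax)).
  move=> x x' y Ax Ax' [a [<- fa]] [a' [<- fa']]; congr val.
  by apply: (@inj _ _ [set: A] f); rewrite ?inE //; apply: val_inj; rewrite fa fa'.
have [A0|/set0P[x0 Ax0]] := eqVneq A set0; first by rewrite A0 card_ge0.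
have [y0 _ _] := rB x0 Ax0.
have /choice[f fP] x : exists y, A x -> B y /\ r x y.
  have [Ax|nAx] := pselect (A x); last by exists y0.
  by have [y By rxy] := rB x Ax; exists y.
suff /injfunPex[g] : exists2 f, set_fun A B f & set_inj A f.
  exact: inj_card_le g.
exists f.
- by move=> x Ax; have [] := fP x Ax.
- move=> x x' /set_mem Ax /set_mem Ax' fxx'.
  apply: (rI _ _ (f x)) => //; first by have [] := fP x Ax.
  by rewrite fxx'; have [] := fP x' Ax'.
Qed.

Lemma card_le_setXX T U (A : set T) (B : set U) :
  A #<= B -> A `*` A #<= B `*` B.
Proof.
move=> /card_le_relP[r [rB rI]]; apply/card_le_relP.
exists (fun p q => r p.1 q.1 /\ r p.2 q.2); split.
  move=> [a b] [/= /rB[a' Ba' ra] /rB[b' Bb' rb]].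
  by exists (a', b').
move=> [a b] [a' b'] [c d] [/= Aa Ab] [/= Aa' Ab'] [ra rb] [ra' rb'].
by rewrite (rI _ _ _ Aa Aa' ra ra') (rI _ _ _ Ab Ab' rb rb').
Qed.

(** Hilbert's hotel: along a copy of the natural numbers inside A, every guest
moves up one room and c takes the first one. *)
Lemma card_le_setU1 T (A : set T) c : infinite_set A -> A `|` [set c] #<= A.
Proof.
move=> /infiniteP /card_le_relP[r [rA rI]].
have /choice[f fP] n : exists y, A y /\ r n y by have [y] := rA n I; exists y.
have fI m n : f m = f n -> m = n.
  move=> mn; apply: (rI _ _ (f m)) => //; first by have [] := fP m.
  by rewrite mn; have [] := fP n.
have [Ac|nAc] := pselect (A c).
  by rewrite setUidl ?card_lexx // => _ ->.
apply/card_le_relP; exists (fun x y =>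
  [\/ x = c /\ y = f 0%N, exists2 n, x = f n & y = f n.+1
    | (forall n, x <> f n) /\ x <> c /\ y = x]); split.
  move=> x [Ax|->]; last first.
    by exists (f 0%N); [have [] := fP 0%N | apply: Or31].
  have [[n xn]|nx] := pselect (exists n, x = f n).
    by exists (f n.+1); [have [] := fP n.+1 | apply: Or32; exists n].
  exists x => //; apply: Or33; split=> [n xn|]; first by apply: nx; exists n.
  by split=> // xc; apply: nAc; rewrite -xc.
move=> x x' y _ _ [[-> ->]|[n -> ->]|[nx [xc ->]]] [[-> ]|[m -> ]|[nx' [xc' ]]] //.
- by move=> /fI.
- by move=> fx; case: (nx' 0%N).
- by move=> /fI.
- by move=> /fI[->].
- by move=> fx; case: (nx' n.+1).
- by move=> fx; case: (nx 0%N).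
- by move=> fx; case: (nx m.+1).
Qed.

(** An element of A is determined by the index of a piece that contains it and
by its place within that piece. *)
Lemma card_le_cover T J M (A : set T) (P : set J) (F : J -> set T) (N : set M) :
  P #<= N -> (forall j, P j -> F j #<= N) -> A `<=` \bigcup_(j in P) F j ->
  A #<= N `*` N.
Proof.
move=> /card_le_relP[r [rN rI]] FN AF; apply/card_le_relP.
have /choice[q qP] j : exists q : T -> M -> Prop, P j ->
    (forall x, F j x -> exists2 y, N y & q x y) /\
    (forall x x' y, F j x -> F j x' -> q x y -> q x' y -> x = x').
  have [Pj|nPj] := pselect (P j); last by exists (fun _ _ => True).
  by have /card_le_relP[q qP] := FN j Pj; exists q.
have [->|/set0P[a /AF[j0 _ _]]] := eqVneq A set0.
  by exists (fun _ _ => True); split.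
have /choice[k kP] x : exists j, A x -> P j /\ F j x.
  have [Ax|nAx] := pselect (A x); last by exists j0.
  by have [j] := AF x Ax; exists j.
exists (fun x p => r (k x) p.1 /\ q (k x) x p.2); split.
  move=> x /kP[Pk Fk]; have [n Nn rn] := rN _ Pk.
  by have [n' Nn' qn'] := (qP _ Pk).1 x Fk; exists (n, n').
move=> x x' [n n'] /kP[/= Pk Fk] /kP[Pk' Fk'] [rx qx] [rx' qx'].
have kk : k x = k x' by apply: rI rx rx'.
by apply: (qP _ Pk).2 Fk _ qx _; rewrite kk.
Qed.

Lemma infinite_card_le_setU1 T U (M : set U) (A : set T) c :
  infinite_set M -> A #<= M -> A `|` [set c] #<= M.
Proof.
move=> iM AM; have [fA|iA] := pselect (finite_set A).
  apply: (@card_le_trans _ _ _ [set: nat]); last exact/infiniteP.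
  by apply: finite_set_countable; rewrite finite_setU; split.
exact: card_le_trans (card_le_setU1 _ iA) AM.
Qed.

(** * Strict well-orders *)

(** In terms of the strict order, x <= y reads ~ lt y x. *)
Record strict_wo T (lt : T -> T -> Prop) : Prop := StrictWo {
  swo_irr : forall x, ~ lt x x;
  swo_trans : forall y x z, lt x y -> lt y z -> lt x z;
  swo_total : forall x y, [\/ lt x y, x = y | lt y x];
  swo_min : forall A : set T, A !=set0 ->
    exists2 m, A m & forall x, A x -> ~ lt x m
}.

Definition below T (lt : T -> T -> Prop) x : set T := [set y | lt y x].

Lemma swo_wf T (lt : T -> T -> Prop) : strict_wo lt -> well_founded lt.
Proof.
move=> wo; apply: contrapT => /existsNP[x nx].
have [m nm mmin] := swo_min wo (ex_intro [set x | ~ Acc lt x] x nx).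
apply: nm; constructor => y ym; apply: contrapT => ny.
exact: (mmin y ny).
Qed.

Lemma swo_lex T U (ltT : T -> T -> Prop) (ltU : U -> U -> Prop) :
  strict_wo ltT -> strict_wo ltU ->
  strict_wo (fun p q : T * U => ltT p.1 q.1 \/ p.1 = q.1 /\ ltU p.2 q.2).
Proof.
move=> woT woU; split.
- by move=> [a b] /= [/(swo_irr woT)//|[_ /(swo_irr woU)]].
- move=> [a b] [c d] [e f] /= [ca|[-> db]] [ae|[<- bf]].
  + by left; apply: (swo_trans woT) ae.
  + by left.
  + by left.
  + by right; split=> //; apply: (swo_trans woU) bf.
- move=> [a b] [c d] /=; have [ac|<-|ca] := swo_total woT a c.
  + by apply: Or31; left.
  + have [bd|<-|db] := swo_total woU b d.
    * by apply: Or31; right.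
    * exact: Or32.
    * by apply: Or33; right.
  + by apply: Or33; left.
- move=> A [[a b] Aab].
  have [|m [n Amn] mmin] := swo_min woT (A := [set a | exists b, A (a, b)]).
    by exists a, b.
  have [|l Aml lmin] := swo_min woU (A := [set b | A (m, b)]); first by exists n.
  exists (m, l) => // -[c d] Acd /= [cm|[cm dl]].
    by apply: mmin cm; exists d.
  by apply: lmin dl; rewrite /= -cm.
Qed.

Lemma swo_preimage T U (f : T -> U) (lt : U -> U -> Prop) :
  injective f -> strict_wo lt -> strict_wo (fun x y => lt (f x) (f y)).
Proof.
move=> fI wo; split.
- by move=> x; apply: swo_irr.
- by move=> y x z; apply: swo_trans.
- move=> x y; have [h|/fI h|h] := swo_total wo (f x) (f y).
  + exact: Or31.
  + exact: Or32.
  + exact: Or33.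
- move=> A [x Ax]; have [|m [y Ay <-] mmin] := swo_min wo (A := f @` A).
    by exists (f x), x.
  by exists y => // z Az; apply: mmin; exists z.
Qed.

(** By recursion along the well-order, each p in D picks an element of B that
no earlier one has picked; B cannot be exhausted before p by hypothesis. *)
Lemma greedy_card_le T U (lt : T -> T -> Prop) (D : set T) (B : set U) :
  strict_wo lt ->
  (forall p, D p -> ~ (B #<= D `&` below lt p)) -> D #<= B.
Proof.
move=> wo DB.
have [->|/set0P[p0 Dp0]] := eqVneq D set0; first exact: card_ge0.
have [B0|/set0P[b0 Bb0]] := eqVneq B set0.
  by case: (DB p0 Dp0); rewrite B0 card_ge0.
have /choice[sel selP] (A : set U) : exists b, A !=set0 -> A b.
  by have [[b Ab]|nA] := pselect (A !=set0); [exists b|exists b0].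
pose step p (rec : forall q, lt q p -> U) : U :=
  sel [set b | B b /\ forall q (qp : lt q p), D q -> rec q qp <> b].
pose e := Fix (swo_wf wo) (fun=> U) step.
have eE p : e p = sel [set b | B b /\ forall q, lt q p -> D q -> e q <> b].
  rewrite {1}/e Fix_eq // => x f g fg; rewrite /step.
  congr (sel _); apply: eq_set => b.
  by under eq_forall do under eq_forall do rewrite fg.
have eP p : D p -> B (e p) /\ forall q, lt q p -> D q -> e q <> e p.
  move=> Dp; rewrite (eE p).
  suff [b Bb] : [set b | B b /\ forall q, lt q p -> D q -> e q <> b] !=set0.
    by have := selP _ (ex_intro _ b Bb).
  apply: contrapT => none; apply: (DB p Dp); apply/card_le_relP.
  exists (fun b q => e q = b); split=> [b Bb|b b' q _ _ <- <-] //.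
  apply: contrapT => nq; apply: none; exists b; split=> // q qp Dq eq_.
  by apply: nq; exists q.
apply/card_le_relP; exists (fun p b => e p = b); split=> [p Dp|p q b Dp Dq epb eqb].
  by exists (e p) => //; have [] := eP p Dp.
have [pq|//|qp] := swo_total wo p q.
- by have [_ /(_ p pq Dp)] := eP q Dq; rewrite epb eqb.
- by have [_ /(_ q qp Dq)] := eP p Dp; rewrite epb eqb.
Qed.

Lemma well_order_strict (K : choiceType) (R : rel K) :
  wochoice.well_order R -> strict_wo (fun x y => ~~ R y x).
Proof.
move=> wo.
have min3 x y z : exists m, [/\ m \in [:: x; y; z], R m x, R m y & R m z].
  have [|m [[m3 mR] _]] := wo (mem [:: x; y; z]).
    by exists x; rewrite inE eqxx.
  by exists m; split=> //; apply: mR; rewrite !inE eqxx ?orbT.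
have refl x : R x x.
  have [m [+ h _ _]] := min3 x x x.
  by rewrite !inE !orbb => /eqP mx; rewrite -{1}mx.
have tot x y : R x y || R y x.
  have [m [+ h1 h2 _]] := min3 x y y.
  by rewrite !inE orbb => /orP[]/eqP mE; subst m; rewrite ?h1 ?h2 ?orbT.
have anti x y : R x y -> R y x -> x = y.
  move=> xy yx; have [|m [_ mU]] := wo (mem [:: x; y]).
    by exists x; rewrite inE eqxx.
  rewrite -(mU x) ?(mU y) //; split; rewrite ?inE ?eqxx ?orbT //.
    by move=> z; rewrite !inE => /orP[]/eqP->.
  by move=> z; rewrite !inE => /orP[]/eqP->.
split.
- by move=> x; rewrite refl.
- move=> y x z nyx nzy; apply/negP => zx.
  have [m [+ mx my mz]] := min3 x y z; rewrite !inE => /or3P[]/eqP mE; subst m.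
  + by move: nzy; rewrite -(anti _ _ mz zx) my.
  + by rewrite mx in nyx.
  + by rewrite my in nzy.
- move=> x y; case xy : (R x y); case yx : (R y x).
  + by apply: Or32; apply: anti.
  + by apply: Or31.
  + by apply: Or33.
  + by have := tot x y; rewrite xy yx.
- move=> A [a Aa]; have [|m [[/set_mem Am mR] _]] := wo (mem A).
    by exists a; apply: mem_set.
  by exists m => // x Ax; rewrite mR //; apply: mem_set.
Qed.

Section WellOrder.
Variables (K : choiceType) (lt : K -> K -> Prop).
Hypothesis wo : strict_wo lt.
Local Notation "x ≺ y" := (lt x y) (at level 70).
Local Notation below := (below lt).

Lemma swo_nlt_sub x y : ~ y ≺ x -> below x `<=` below y.
Proof.
move=> yx z zx; have [//|zy|yz] := swo_total wo z y.
  by case: yx; rewrite -zy.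
by case: yx; apply: swo_trans wo _ _ _ yz zx.
Qed.

Lemma swo_lt_nlt z x y : x ≺ z -> ~ y ≺ z -> x ≺ y.
Proof. by move=> xz yz; apply: swo_nlt_sub yz _ _. Qed.

Lemma swo_nlt_trans y x z : ~ y ≺ x -> y ≺ z -> x ≺ z.
Proof.
move=> yx yz; have [xy|->//|//] := swo_total wo x y.
exact: swo_trans wo _ _ _ xy yz.
Qed.

Lemma swo_max x y : exists m, [/\ ~ m ≺ x, ~ m ≺ y & m = x \/ m = y].
Proof.
have [xy|<-|yx] := swo_total wo x y.
- exists y; split; [|exact: swo_irr|by right].
  by move=> /(swo_trans wo xy); exact: swo_irr.
- by exists x; split; [exact: swo_irr|exact: swo_irr|left].
- exists x; split; [exact: swo_irr| |by left].
  by move=> /(swo_trans wo yx); exact: swo_irr.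
Qed.

(** Hessenberg's theorem. Let x be a minimal counterexample, and order the
pairs of elements below x first by their maximum, as Goedel does. The pairs
preceding (a, b) lie in the square of a segment shorter than x, and by
minimality that square does not exhaust the elements below x, so the pairs
embed greedily into the elements below x. *)
Lemma card_square_below x :
  infinite_set (below x) -> below x `*` below x #<= below x.
Proof.
apply: contraPP => nx ix; pose bad := [set x | infinite_set (below x) /\
  ~ (below x `*` below x #<= below x)].
have [{ix}x0 [ix {nx}nx] xmin] := swo_min wo (ex_intro bad x (conj ix nx)).
move: x0 ix nx xmin => {}x ix nx xmin.
have sq z : z ≺ x -> infinite_set (below z) ->
    below z `*` below z #<= below z.
  by move=> zx iz; apply: contrapT => nz; apply: (xmin z).
have small z : z ≺ x -> ~ (below x #<= below z).
  move=> zx xz; apply: nx.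
  have iz : infinite_set (below z) by move=> /(card_le_finite xz).
  apply: card_le_trans (card_le_setXX xz) _.
  apply: card_le_trans (sq z zx iz) _; apply: subset_card_le.
  by apply: swo_nlt_sub; move=> /(swo_trans wo zx); exact: swo_irr.
have /choice[mx mxP] := fun p : K * K => swo_max p.1 p.2.
pose key p := (mx p, p).
have keyI : injective key by move=> p q [].
have gwo := swo_preimage keyI (swo_lex wo (swo_lex wo wo)).
apply: nx; apply: (greedy_card_le gwo) => p [/= p1 p2].
have mpx : mx p ≺ x by have [_ _ [->|->]] := mxP p.
have predp : (below x `*` below x) `&`
    [set q | mx q ≺ mx p \/ mx q = mx p /\ (q.1 ≺ p.1 \/ q.1 = p.1 /\ q.2 ≺ p.2)]
    `<=` (below (mx p) `|` [set mx p]) `*` (below (mx p) `|` [set mx p]).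
  move=> q [_ /= qp]; have nq : ~ mx p ≺ mx q.
    case: qp => [qp|[-> _]]; last exact: swo_irr.
    by move=> /(swo_trans wo qp); exact: swo_irr.
  have [q1 q2 _] := mxP q; split.
    have [h|h|h] := swo_total wo q.1 (mx p); [by left|by right|].
    by case: nq; apply: swo_lt_nlt h q1.
  have [h|h|h] := swo_total wo q.2 (mx p); [by left|by right|].
  by case: nq; apply: swo_lt_nlt h q2.
move=> /card_le_trans/(_ (subset_card_le predp)) xm.
have [fm|im] := pselect (finite_set (below (mx p))).
  by apply: ix; apply: card_le_finite xm _; apply: finite_setX;
    rewrite finite_setU; split=> //; apply: finite_set1.
apply: (small _ mpx); apply: card_le_trans xm _.
apply: card_le_trans (card_le_setXX (card_le_setU1 _ im)) _.
exact: sq.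
Qed.

End WellOrder.

(** * Regular initial segments and pressing down *)

Section Regular.
Variables (K : choiceType) (lt : K -> K -> Prop).
Hypothesis wo : strict_wo lt.
Local Notation "x ≺ y" := (lt x y) (at level 70).
Local Notation below := (below lt).

Definition seq_bounded (I : set K) := forall g : nat -> K,
  (forall n, I (g n)) -> exists2 u, I u & forall n, g n ≺ u.

Definition initial (I : set K) := forall x y, I y -> x ≺ y -> I x.

(** These are the initial segments whose order type is zero or a regular
uncountable cardinal. *)
Record regular (I : set K) : Prop := Regular {
  reg_initial : initial I;
  reg_below : forall b (g : K -> K), I b -> (forall x, x ≺ b -> I (g x)) ->
    exists2 u, I u & forall x, x ≺ b -> g x ≺ u;
  reg_seq : seq_bounded I
}.

Definition unbounded (I S : set K) :=
  forall x, I x -> exists y, [/\ I y, S y & x ≺ y].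

Lemma not_unbounded (I S : set K) : ~ unbounded I S ->
  exists2 u, I u & forall y, I y -> S y -> ~ u ≺ y.
Proof.
move=> /existsNP[u /not_implyP[Iu nu]]; exists u => // y Iy Sy uy.
by apply: nu; exists y.
Qed.

Lemma seq_bounded2 (I : set K) : seq_bounded I -> forall x y, I x -> I y ->
  exists u, [/\ I u, x ≺ u & y ≺ u].
Proof.
move=> sI x y Ix Iy.
have [|u Iu uP] := sI (fun n => if n is 0%N then x else y); first by case.
by exists u; split => //; [exact: (uP 0%N)|exact: (uP 1%N)].
Qed.

(** The point d is the least upper bound of the increasing sequence a. *)
Definition ladder_limit (I : set K) (a : nat -> K) (d : K) :=
  (forall n, I (a n) /\ a n ≺ a n.+1) /\ I d /\
  (forall n, a n ≺ d) /\ forall z, z ≺ d -> exists n, z ≺ a n.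

Lemma ladder (I : set K) x0 (f : K -> K) :
  initial I -> seq_bounded I -> I x0 -> (forall x, I x -> I (f x)) ->
  exists a d, ladder_limit I a d /\ a 0%N = x0 /\ forall n, f (a n) ≺ a n.+1.
Proof.
move=> iI sI Ix0 If.
have /choice[g gP] x : exists u, I x -> [/\ I u, x ≺ u & f x ≺ u].
  have [Ix|nIx] := pselect (I x); last by exists x.
  by have [u] := seq_bounded2 sI Ix (If x Ix); exists u.
pose a n := iter n g x0.
have Ia n : I (a n) by elim: n => // n /gP[].
have [u Iu au] := sI a Ia.
have [d [Id ad] dmin] := swo_min wo (ex_intro
  [set d | I d /\ forall n, a n ≺ d] u (conj Iu au)).
exists a, d; split; last by split=> // n; have [] := gP _ (Ia n).
split; first by move=> n; split => //; have [] := gP _ (Ia n).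
split=> //; split=> // z zd; apply: contrapT => nz.
have az n : ~ z ≺ a n by move=> h; apply: nz; exists n.
apply: (dmin z) => //; split=> [|n]; first exact: iI zd.
by apply: swo_lt_nlt wo _ _ _ _ (az n.+1); have [] := gP _ (Ia n).
Qed.

Lemma ladder_limit_seq (I : set K) a d (s : seq K) :
  ladder_limit I a d -> (forall z, z \in s -> z ≺ d) ->
  exists n, forall z, z \in s -> z ≺ a n.
Proof.
move=> [Ia [_ [_ da]]]; have amono m n z : z ≺ a m -> z ≺ a (m + n)%N.
  move=> zm; elim: n => [|n IHn]; first by rewrite addn0.
  by rewrite addnS; apply: swo_trans wo _ _ _ IHn (Ia _).2.
elim: s => [|x s IHs] sd; first by exists 0%N.
have [z zs|n sn] := IHs; first by apply: sd; rewrite inE zs orbT.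
have [|m xm] := da x; first by apply: sd; rewrite inE eqxx.
exists (n + m)%N => z; rewrite inE => /predU1P[->|zs].
  by rewrite addnC; apply: amono.
by apply: amono; apply: sn.
Qed.

(** Otherwise each j has a bound h j for the k in C with s k below j. A ladder
that climbs faster than h and f has a limit d in C; the finite set s d lies
below some a n, whence d < h (a n) < d. *)
Lemma reflection (I C : set K) x0 (f : K -> K) (s : K -> seq K) :
  initial I -> seq_bounded I -> I x0 -> (forall x, I x -> I (f x)) ->
  (forall a d, ladder_limit I a d -> a 0%N = x0 ->
     (forall n, f (a n) ≺ a n.+1) -> C d) ->
  (forall k, I k -> C k -> forall z, z \in s k -> z ≺ k) ->
  exists2 j, I j & unbounded I [set k | C k /\ forall z, z \in s k -> z ≺ j].
Proof.
move=> iI sI Ix0 If clC sk; apply: contrapT => nj.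
have /choice[h hP] j : exists u, I j -> [/\ I u, f j ≺ u &
    forall k, I k -> C k -> (forall z, z \in s k -> z ≺ j) -> k ≺ u].
  have [Ij|nIj] := pselect (I j); last by exists j.
  have [unb|/not_unbounded[u Iu uP]] :=
      pselect (unbounded I [set k | C k /\ forall z, z \in s k -> z ≺ j]).
    by case: nj; exists j.
  have [v [Iv uv fv]] := seq_bounded2 sI Iu (If j Ij).
  exists v => _; split=> // k Ik Ck kj.
  by apply: swo_nlt_trans wo _ _ _ _ uv; apply: uP.
have [|a [d [ladd [a0 ha]]]] := ladder iI sI Ix0 (f := h); first by move=> x /hP[].
have [Ia [Id [ad _]]] := ladd.
have Cd : C d.
  apply: (clC a) => // n.
  by apply: swo_trans wo _ _ _ _ (ha n); have [] := hP _ (Ia n).1.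
have [n sn] := ladder_limit_seq ladd (sk d Id Cd).
have [_ _ /(_ d Id Cd sn) dh] := hP _ (Ia n).1.
apply: (swo_irr wo (x := d)); apply: swo_trans wo _ _ _ dh _.
exact: swo_trans wo _ _ _ (ha n) (ad n.+1).
Qed.

(** Induction on m replaces the cardinal arithmetic that would count the finite
sequences below j: the bounds for the tails, as the head ranges below j, are
themselves bounded by regularity. *)
Lemma regular_seq_size (I : set K) x0 m :
  regular I -> I x0 -> forall j, I j -> forall h : seq K -> K,
  (forall s, I (h s)) ->
  exists2 u, I u & forall s, size s = m -> (forall z, z \in s -> z ≺ j) -> h s ≺ u.
Proof.
move=> rI Ix0 j Ij; elim: m => [|m IHm] h Ih.
  have [u [Iu hu _]] := seq_bounded2 (reg_seq rI) (Ih [::]) Ix0.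
  by exists u => // -[].
have /choice[g gP] x : exists u, I u /\ forall s, size s = m ->
    (forall z, z \in s -> z ≺ j) -> h (x :: s) ≺ u.
  by have [//|u Iu uP] := IHm (fun s => h (x :: s)); exists u.
have [|u Iu uP] := reg_below rI (g := g) Ij; first by move=> x _; case: (gP x).
exists u => // -[//|x s] [sm] sj.
have xj : x ≺ j by apply: sj; rewrite inE eqxx.
apply: swo_trans wo _ _ _ _ (uP x xj); have [_] := gP x.
by apply=> // z zs; apply: sj; rewrite inE zs orbT.
Qed.

Lemma regular_seq (I : set K) x0 :
  regular I -> I x0 -> forall j, I j -> forall h : seq K -> K,
  (forall s, I (h s)) ->
  exists2 u, I u & forall s, (forall z, z \in s -> z ≺ j) -> h s ≺ u.
Proof.
move=> rI Ix0 j Ij h Ih.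
have /choice[g gP] m : exists u, I u /\ forall s, size s = m ->
    (forall z, z \in s -> z ≺ j) -> h s ≺ u.
  by have [u] := regular_seq_size m rI Ix0 Ij Ih; exists u.
have [|u Iu uP] := reg_seq rI (g := g); first by move=> n; case: (gP n).
exists u => // s sj; apply: swo_trans wo _ _ _ _ (uP (size s)).
by have [_] := gP (size s); apply.
Qed.

(** Fodor's lemma for finite sets of smaller indices, together with a label
that takes countably many values once that finite set is fixed. If all the
fibers were bounded, regularity would bound at once all the k for which s k
lies below a given j, which [reflection] excludes for a suitable j. *)
Lemma pressing_down (I : set K) x0 (s : K -> seq K) (L : Type) (q : K -> L)
    (B : seq K -> set L) :
  regular I -> I x0 -> (forall k, I k -> forall z, z \in s k -> z ≺ k) ->
  (forall t, countable (B t)) -> (forall k, I k -> B (s k) (q k)) ->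
  exists t l, unbounded I [set k | s k = t /\ q k = l].
Proof.
move=> rI Ix0 sk cB Bq; apply: contrapT => none.
have /choice[h hP] t : exists u, I u /\ forall k, I k -> s k = t -> k ≺ u.
  have /card_le_relP[r [rB rI']] := cB t.
  have /choice[g gP] n : exists u, I u /\
      forall k, I k -> s k = t -> r (q k) n -> ~ u ≺ k.
    have [[l Bl rl]|nl] := pselect (exists2 l, B t l & r l n); last first.
      by exists x0; split=> // k Ik skt rk; case: nl; exists (q k) => //;
        rewrite -skt; apply: Bq.
    have [unb|/not_unbounded[u Iu uP]] :=
        pselect (unbounded I [set k | s k = t /\ q k = l]).
      by case: none; exists t, l.
    exists u; split=> // k Ik skt rk; apply: uP => //; split=> //.
    by apply: rI' rk rl; rewrite // -skt; apply: Bq.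
  have [|u Iu uP] := reg_seq rI (g := g); first by move=> n; case: (gP n).
  exists u; split=> // k Ik skt.
  have [|n _ rn] := rB (q k); first by rewrite -skt; apply: Bq.
  by apply: swo_nlt_trans wo _ _ _ _ (uP n); apply: (gP n).2.
have [j Ij junb] := reflection (C := setT) (f := id) (reg_initial rI) (reg_seq rI)
  Ix0 (fun _ => id) (fun _ _ _ _ _ => Logic.I) (fun k Ik _ => sk k Ik).
have [|u Iu uP] := regular_seq rI Ix0 Ij (h := h); first by move=> t; case: (hP t).
have [k [Ik [_ kj] uk]] := junb u Iu.
apply: (swo_irr wo (x := k)); apply: swo_trans wo _ _ _ _ uk.
by apply: swo_trans wo _ _ _ _ (uP (s k) kj); apply: (hP _).2.
Qed.

(** An injection of S into the elements below some p would be inverted into a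
family indexed below p and unbounded in I. *)
Lemma unbounded_card_ge (I S : set K) :
  regular I -> S `<=` I -> unbounded I S -> I #<= S.
Proof.
move=> rI SI unb; apply: (greedy_card_le wo) => p Ip /card_le_relP[r [rS rI']].
have /choice[g gP] x : exists y, x ≺ p -> I y /\ forall s, S s -> r s x -> s = y.
  have [[s Ss rs]|ns] := pselect (exists2 s, S s & r s x); last first.
    by exists p => xp; split=> // s Ss rs; case: ns; exists s.
  by exists s => _; split; [exact: SI|move=> s' Ss' rs'; apply: rI' rs].
have [|u Iu uP] := reg_below rI (g := g) Ip; first by move=> x /gP[].
have [s [Is Ss us]] := unb u Iu.
have [x [_ xp] rx] := rS s Ss.
apply: (swo_irr wo (x := u)); apply: swo_trans wo _ _ _ us _.
by rewrite ((gP x xp).2 s Ss rx); apply: uP.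
Qed.

End Regular.

(** * Neighbourhoods in a totally bounded paratopological group *)

Definition dense_in X (T : set (set X)) (E Q : set X) :=
  forall P, T P -> P !=set0 -> P `<=` Q -> P `&` E !=set0.

(** Finitely many nowhere dense sets do not cover X: starting from X, shrink a
nonempty member of T successively to avoid each E j. *)
Lemma finite_cover_dense X (J : eqType) (T : set (set X)) (E : J -> set X)
    (s : seq J) :
  T setT -> [set: X] !=set0 -> (forall x, exists2 j, j \in s & E j x) ->
  exists j Q, [/\ j \in s, T Q, Q !=set0 & dense_in T (E j) Q].
Proof.
move=> TT X0 cov; apply: contrapT => none.
have [Q [_ [q Qq] Qs]] : exists Q, [/\ T Q, Q !=set0 &
    forall j, j \in s -> Q `&` E j = set0].
  have : {subset s <= s} by [].
  elim: {1 3}s => [|j r IHr] rs; first by exists setT.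
  have [i ir|Q [TQ Q0 Qr]] := IHr; first by apply: rs; rewrite inE ir orbT.
  have [|nd] := pselect (dense_in T (E j) Q).
    by move=> dj; case: none; exists j, Q; split=> //; apply: rs; rewrite inE eqxx.
  move: nd => /existsNP[P /not_implyP[TP /not_implyP[P0 /not_implyP[PQ PE]]]].
  exists P; split=> // i; rewrite inE => /predU1P[->|ir].
    by apply: contrapT => /eqP/set0P.
  by apply/seteqP; split=> // x [Px Ex]; rewrite -(Qr i ir); split=> //; apply: PQ.
have [j js Ej] := cov q.
by have : set0 q by rewrite -(Qs j js); split.
Qed.

Section Group.
Variable G : paratopologicalGroupType.
Implicit Types (x y g : G) (U V O : set G).

Lemma nbhs_mulg x y U : nbhs (x * y)%g U ->
  exists A B, [/\ nbhs x A, nbhs y B & forall a b, A a -> B b -> U (a * b)%g].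
Proof.
move=> /(@mulg_continuous G (x, y))[[A B] /= [nA nB] AB].
by exists A, B; split=> // a b Aa Bb; apply: (AB (a, b)).
Qed.

Lemma nbhs1_square U : nbhs (1%g : G) U ->
  exists2 V, nbhs (1%g : G) V & forall v w, V v -> V w -> U (v * w)%g.
Proof.
rewrite -{1}[1%g]mulg1 => /nbhs_mulg[A [B [nA nB AB]]].
by exists (A `&` B); [apply: filterI|move=> v w [Av _] [_ Bw]; apply: AB].
Qed.

Lemma nbhs_mulgl x y U : nbhs (x * y)%g U -> nbhs y [set z | U (x * z)%g].
Proof.
move=> /nbhs_mulg[A [B [nA nB AB]]]; apply: filterS nB => b Bb.
by apply: AB => //; apply: nbhs_singleton.
Qed.

Lemma nbhs_mulgr x y U : nbhs (x * y)%g U -> nbhs x [set z | U (z * y)%g].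
Proof.
move=> /nbhs_mulg[A [B [nA nB AB]]]; apply: filterS nA => a Aa.
by apply: AB => //; apply: nbhs_singleton.
Qed.

Lemma nbhs1_translate x U : nbhs x U -> nbhs (1%g : G) [set v | U (x * v)%g].
Proof. by rewrite -{1}[x]mulg1; exact: nbhs_mulgl. Qed.

Lemma nbhs_translate x U : nbhs (1%g : G) [set v | U (x * v)%g] -> nbhs x U.
Proof.
rewrite -{1}[1%g](mulVg x) => /nbhs_mulgl; apply: filterS => z /=.
by rewrite mulVKg.
Qed.

Hypothesis hG : totally_bounded G.

Lemma totally_bounded_seq U : nbhs (1%g : G) U ->
  exists s : seq G, forall g, exists f u, [/\ f \in s, U u & g = (f * u)%g].
Proof.
move=> /hG[F /finite_seqP[s ->] FU]; exists s => g.
have : [set: G] g by [].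
by rewrite -FU => -[f /= fs [u Uu <-]]; exists f, u.
Qed.

(** Let V V be contained in U and G = s V, with s finite. By inversion, right
translates of V^-1 by s^-1 cover G, so V^-1 is dense in some nonempty open set
P, up to right translation. Every y in P has a neighbourhood y V that meets V^-1,
whence y^-1 is in V V. Thus P is contained in U^-1, and finitely many left
translates of P cover G. *)
Lemma totally_bounded_inv U : nbhs (1%g : G) U ->
  exists s : seq G, forall g, exists d u, [/\ d \in s, U u & d = (g * u)%g].
Proof.
move=> /nbhs1_square[V nV VU]; have [s sP] := totally_bounded_seq nV.
have [||g|f [P [fs oP [p Pp] dP]]] := @finite_cover_dense G _
  [set O : set G | open O] (fun f => [set g | exists2 v, V v & (g^-1)%g = (f * v)%g]) s.
- exact: openT.
- by exists 1%g.
- by have [f [v [fs Vv gE]]] := sP (g^-1)%g; exists f => //; exists v.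
have PU y : P (y * f^-1)%g -> U (y^-1)%g.
  move=> Py.
  (* The points y v f^-1, with v interior to V, form a neighbourhood of y f^-1. *)
  have [z [Pz [v Vv zE]]] : (P `&` [set z | V^° (y^-1 * z * f)%g]) `&`
      [set g | exists2 v, V v & (g^-1)%g = (f * v)%g] !=set0.
    apply: dP; last by move=> z [].
      apply: openI => //; rewrite openE => z /= Vz.
      have /nbhs_mulgr/nbhs_mulgl : nbhs (y^-1 * z * f)%g V^°.
        by apply: open_nbhs_nbhs; split=> //; apply: open_interior.
      by [].
    by exists (y * f^-1)%g; split=> //=; rewrite mulKg mulVg; apply: nV.
  have -> : (y^-1 = (y^-1 * z * f) * v)%g.
    by rewrite -mulgA -zE mulgK.
  by apply: VU => //; apply: interior_subset; exact: Pz.2.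
pose y0 := (p * f)%g.
have nN : nbhs (1%g : G) [set u | P (y0 * u * f^-1)%g].
  have /nbhs_mulgr/nbhs_mulgl : nbhs (y0 * 1 * f^-1)%g P; last by [].
  by apply: open_nbhs_nbhs; split=> //; rewrite mulg1 mulgK.
have [r rP] := totally_bounded_seq nN.
exists [seq (h * y0^-1)%g | h <- r] => g.
have [h [u [hr Pu ->]]] := rP g.
exists (h * y0^-1)%g, ((y0 * u)^-1)%g; split.
- by apply/mapP; exists h.
- exact: PU.
- by rewrite mulgKA.
Qed.

Section Topology.
Variables (K : choiceType) (V : K -> nat -> set G) (D : seq (K * nat) -> seq G).
Hypothesis nbhsV : forall k n, nbhs (1%g : G) (V k n).
Hypothesis squareV : forall k n v w,
  V k n.+1 v -> V k n.+1 w -> V k n (v * w)%g.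

Definition over (A : set K) (t : seq (K * nat)) := forall p, p \in t -> A p.1.

Definition meetV (t : seq (K * nat)) : set G :=
  [set g | forall p, p \in t -> V p.1 p.2 g].

Hypothesis invD : forall t g,
  exists d u, [/\ d \in D t, meetV t u & d = (g * u)%g].

(** The interior for the topology T_A; [openV] below is the family of its open
sets. *)
Definition interiorV (A : set K) (E : set G) : set G :=
  [set x | exists2 t, over A t & forall v, meetV t v -> E (x * v)%g].

Definition openV (A : set K) (O : set G) := O `<=` interiorV A O.

(** The translate by d of the interior of [meetV t], the interior being taken
in the topology generated by the indices that occur in t. *)
Definition cell (t : seq (K * nat)) (d : G) : set G :=
  [set g | interiorV [set k | exists n, (k, n) \in t] (meetV t) (d^-1 * g)%g].

Definition cells (s : seq K) : set (set G) :=
  [set Q | exists t d, [/\ over [set` s] t, d \in D t & Q = cell t d]].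

Lemma nbhs_meetV t : nbhs (1%g : G) (meetV t).
Proof.
elim: t => [|p t IHt]; first by apply: filterS (@filterT _ _ _) => g _ p.
apply: filterS (filterI (nbhsV p.1 p.2) IHt) => g [Vg tg] q.
by rewrite inE => /predU1P[->|/tg].
Qed.

Lemma meetV1 t : meetV t 1%g.
Proof. exact: nbhs_singleton (nbhs_meetV t). Qed.

Lemma meetV_cat t t' : meetV (t ++ t') `<=` meetV t `&` meetV t'.
Proof. by move=> g tg; split=> p pt; apply: tg; rewrite mem_cat pt ?orbT. Qed.

Lemma square_meetV A t : over A t -> exists2 t', over A t' &
  forall v w, meetV t' v -> meetV t' w -> meetV t (v * w)%g.
Proof.
move=> At; exists [seq (p.1, p.2.+1) | p <- t].
  by move=> _ /mapP[p pt ->]; apply: At pt.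
move=> v w tv tw p pt.
by apply: squareV; [apply: (tv (p.1, p.2.+1))|apply: (tw (p.1, p.2.+1))];
  apply: map_f pt.
Qed.

Lemma interiorV_sub A E : interiorV A E `<=` E.
Proof. by move=> x [t _ /(_ 1%g (@meetV1 t))]; rewrite mulg1. Qed.

Lemma openV_interior A E : openV A (interiorV A E).
Proof.
move=> x [t At tE]; have [t' At' tt'] := square_meetV At.
exists t' => // v tv; exists t' => // w tw.
by rewrite -mulgA; apply: tE; apply: tt'.
Qed.

Lemma openV_mono A A' O : A `<=` A' -> openV A O -> openV A' O.
Proof. by move=> AA' oO x /oO[t At tO]; exists t => // p /At/AA'. Qed.

Lemma openV_setI A O O' : openV A O -> openV A O' -> openV A (O `&` O').
Proof.
move=> oO oO' x [/oO[t At tO] /oO'[t' At' tO']]; exists (t ++ t').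
  by move=> p; rewrite mem_cat => /orP[/At|/At'].
by move=> v /meetV_cat[tv tv']; split; [apply: tO|apply: tO'].
Qed.

Lemma openV_translate A h O : openV A O -> openV A [set g | O (h * g)%g].
Proof. by move=> oO x /oO[t At tO]; exists t => // v /tO; rewrite /= mulgA. Qed.

Lemma open_openV A O : openV A O -> open O.
Proof.
move=> oO; rewrite openE => x /oO[t _ tO]; apply: nbhs_translate.
by apply: filterS (nbhs_meetV t).
Qed.

Lemma openV_cell A t d : over A t -> openV A (cell t d).
Proof.
move=> At; apply: openV_translate; apply: openV_mono _ (@openV_interior _ _).
by move=> k [n /At].
Qed.

Lemma cellP t d : cell t d d.
Proof.
exists t; first by move=> [k n] kt; exists n.
by move=> v; rewrite mulVg mul1g.
Qed.

(** A finite sequence over the members of s is coded by a sequence of pairs of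
natural numbers, the first ones being positions in s. *)
Lemma countable_cells s : countable (cells s).
Proof.
have [->|k0] : s = [::] \/ exists k0 : K, True.
- by case: s => [|k s]; [left|right; exists k].
- have sub : cells [::] `<=` (cell [::]) @` [set` D [::]].
    move=> Q [[|p t] [d [/= st dt ->]]]; first by exists d.
    by have := st p; rewrite inE eqxx => /(_ isT).
  apply: sub_countable (subset_card_le sub) _.
  by apply: finite_set_countable; apply: finite_image; apply: finite_seq.
pose tt (ns : seq (nat * nat)) :=
  [seq (nth (sval (cid k0)) s p.1, p.2) | p <- ns].
have sub : cells s `<=` \bigcup_(ns in [set: seq (nat * nat)])
    (cell (tt ns)) @` [set` D (tt ns)].
  move=> Q [t [d [st dt ->]]].
  have tE : t = tt [seq (index p.1 s, p.2) | p <- t].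
    rewrite /tt -map_comp -[LHS]map_id; apply/eq_in_map => -[k n] /st /= ks.
    by rewrite nth_index.
  by exists [seq (index p.1 s, p.2) | p <- t] => //; exists d; rewrite -tE.
apply: sub_countable (subset_card_le sub) _.
apply: bigcup_countable => // ns _.
by apply: finite_set_countable; apply: finite_image; apply: finite_seq.
Qed.

(** By finitely many translates of O and left invariance, O is dense in a
nonempty open set of T_A; that one contains a cell, whose centre d is provided
by the finite set D t. *)
Lemma dense_in_cell A O : open O -> O !=set0 ->
  exists t d, [/\ over A t, d \in D t & dense_in (openV A) O (cell t d)].
Proof.
move=> oO [o Oo].
have [|s sP] := totally_bounded_seq (nbhs1_translate (x := o) (U := O) _).
  exact: open_nbhs_nbhs.
have [||g|f [Q [fs oQ [q Qq] dQ]]] := @finite_cover_dense G _ (openV A)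
  (fun f => [set g | O (o * (f^-1 * g))%g]) s.
- by move=> x _; exists [::].
- by exists 1%g.
- by have [f [u [fs Ou ->]]] := sP g; exists f => //=; rewrite mulKg.
pose h := (f * o^-1)%g.
have hE g : (o * (f^-1 * g) = h^-1 * g)%g by rewrite invgM invgK mulgA.
have {}dQ : dense_in (openV A) O [set g | Q (h * g)%g].
  move=> P oP [p Pp] PQ.
  have [||z|z [Pz Oz]] := dQ [set g | P (h^-1 * g)%g].
  - exact: openV_translate.
  - by exists (h * p)%g; rewrite /= mulKg.
  - by move=> /PQ; rewrite /= mulVKg.
  - by exists (h^-1 * z)%g; split=> //; rewrite -hE.
have /(_ (h^-1 * q)%g)[|t At tQ] := @openV_translate A h Q oQ.
  by rewrite /= mulVKg.
have [t' At' tt'] := square_meetV At.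
have [d [u [dt tu dE]]] := invD t' (h^-1 * q)%g.
exists t', d; split=> // P oP P0 PQ; apply: dQ => // x /PQ /interiorV_sub tx.
by have /= := tQ _ (tt' _ _ tu tx); rewrite [(_ * (u * _))%g]mulgA -dE mulVKg.
Qed.

End Topology.
End Group.

(** * Filtrations by coarser topologies *)

(** What the combinatorial part retains of the topologies T_A: B s is the
countable set of cells over the finite set s of indices, and U is a family of
open sets, the k-th of which involves only the index k. *)
Record filtration (X : topologicalType) (K : choiceType)
    (T : set K -> set (set X)) (B : seq K -> set (set X)) (U : K -> set X) : Prop :=
  Filtration {
  fil_mono : forall A A' O, A `<=` A' -> T A O -> T A' O;
  fil_setT : forall A, T A setT;
  fil_setI : forall A O O', T A O -> T A O' -> T A (O `&` O');
  fil_open : forall A O, T A O -> open O;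
  fil_countable : forall s, countable (B s);
  fil_base : forall s Q, B s Q -> T [set` s] Q /\ Q !=set0;
  fil_dense : forall A O, open O -> O !=set0 ->
    exists s Q, [/\ [set` s] `<=` A, B s Q & dense_in (T A) O Q];
  fil_family : forall k, T [set k] (U k) /\ U k !=set0
}.

Lemma filtration_exists (G : paratopologicalGroupType) (K : choiceType)
    (U : K -> set G) :
  totally_bounded G -> (forall k, open (U k) /\ U k !=set0) ->
  exists T B U', filtration T B U' /\ forall k, U' k `<=` U k.
Proof.
move=> hG oU; have /choice[x Ux] k : exists x, U k x by have [_] := oU k.
have /choice[root rootP] (N : set G) : exists N', nbhs (1%g : G) N ->
    nbhs (1%g : G) N' /\ forall v w, N' v -> N' w -> N (v * w)%g.
  have [nN|nN] := pselect (nbhs (1%g : G) N); last by exists N.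
  by have [N'] := nbhs1_square nN; exists N'.
pose V k n := iter n root [set v | U k (x k * v)%g].
have nV k n : nbhs (1%g : G) (V k n).
  elim: n => [|n IHn]; last exact: (rootP _ IHn).1.
  by apply: nbhs1_translate; apply: open_nbhs_nbhs; split=> //; have [] := oU k.
have sV k n v w : V k n.+1 v -> V k n.+1 w -> V k n (v * w)%g.
  exact: (rootP _ (nV k n)).2.
have /choice[D DP] t := totally_bounded_inv hG (@nbhs_meetV _ _ _ nV t).
exists (openV V), (cells V D), (fun k => interiorV V [set k] (U k)).
split; last by move=> k; apply: interiorV_sub.
split.
- by move=> A A' O; apply: openV_mono.
- by move=> A z _; exists [::].
- by move=> A O O'; apply: openV_setI.
- by move=> A O; apply: open_openV.
- by move=> s; apply: countable_cells.
- move=> s Q [t [d [st dt ->]]]; split; first exact: openV_cell.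
  by exists d; apply: cellP.
- move=> A O oO O0; have [t [d [At dt dO]]] := dense_in_cell hG nV sV DP A oO O0.
  exists [seq p.1 | p <- t], (cell V t d); split => //.
    by move=> _ /= /mapP[p pt ->]; apply: At.
  by exists t, d; split=> // p pt; apply: map_f.
- move=> k; split; first exact: openV_interior.
  exists (x k), [:: (k, 0%N)]; first by move=> p; rewrite inE => /eqP->.
  by move=> v /(_ (k, 0%N)); apply; rewrite inE.
Qed.

Section Amalgamation.
Variables (X : topologicalType) (K : choiceType) (lt : K -> K -> Prop).
Variables (T : set K -> set (set X)) (B : seq K -> set (set X)) (U : K -> set X).
Hypotheses (wo : strict_wo lt) (fil : filtration T B U).
Local Notation "x ≺ y" := (lt x y) (at level 70).
Local Notation below := (below lt).

Lemma fil_seqI (F : K -> set X) A (ks : seq K) :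
  (forall k, k \in ks -> T A (F k)) -> T A [set x | forall k, k \in ks -> F k x].
Proof.
elim: ks => [|k ks IHks] TF.
  suff -> : [set x | forall k, k \in [::] -> F k x] = setT by apply: fil_setT fil A.
  by apply/seteqP; split.
suff -> : [set x | forall z, z \in k :: ks -> F z x] =
    F k `&` [set x | forall z, z \in ks -> F z x].
  apply: fil_setI fil _ _ _ _ _; first by apply: TF; rewrite inE eqxx.
  by apply: IHks => z zks; apply: TF; rewrite inE zks orbT.
apply/seteqP; split=> [x Fx|x [Fkx Fx] z]; last by rewrite inE => /predU1P[->|/Fx].
by split=> [|z zks]; apply: Fx; rewrite inE ?eqxx ?zks ?orbT.
Qed.

Lemma seq_max (s : seq K) : s != [::] ->
  exists2 m, m \in s & forall z, z \in s -> ~ m ≺ z.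
Proof.
elim: s => // x s IHs _; have [->|/IHs[m ms mP]] := eqVneq s [::].
  by exists x; rewrite ?inE // => z; rewrite inE => /eqP->; exact: swo_irr.
have [n [nx nm nE]] := swo_max wo x m.
exists n; first by rewrite inE; case: nE => ->; rewrite ?eqxx ?ms ?orbT.
move=> z; rewrite inE => /predU1P[->//|/mP mz nz]; apply: nm.
exact: swo_lt_nlt nz mz.
Qed.

(** The c in D are treated in increasing order. The set P obtained from those
smaller than c is open for indices below c, since it involves only A and the
indices in hi d for smaller d; the hypothesis on c then shrinks P. Hence the
last conclusion, which keeps track of the indices that P involves. *)
Lemma amalgamation (D : seq K) (A : set K) (hi : K -> set K)
    (H : K -> set X -> Prop) (O : set X) :
  T A O -> O !=set0 ->
  (forall c, c \in D -> A `<=` below c) ->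
  (forall c d, c \in D -> d \in D -> c ≺ d -> hi c `<=` below d) ->
  (forall c P P', P' `<=` P -> H c P -> H c P') ->
  (forall c P, c \in D -> T (below c) P -> P !=set0 -> P `<=` O ->
    exists P', [/\ P' `<=` P, P' !=set0, T (hi c) P' & H c P']) ->
  exists P, [/\ P `<=` O, P !=set0, forall c, c \in D -> H c P &
    forall A', A `<=` A' -> (forall c, c \in D -> hi c `<=` A') -> T A' P].
Proof.
move=> TO O0 AD hiD Hmono step.
suff: forall n (E : seq K), (size E <= n)%N -> {subset E <= D} ->
    exists P, [/\ P `<=` O, P !=set0, forall c, c \in E -> H c P &
    forall A', A `<=` A' -> (forall c, c \in E -> hi c `<=` A') -> T A' P].
  by move=> /(_ _ D (leqnn _)); apply.
elim=> [|n IHn] E; first rewrite leqn0 size_eq0 => /eqP-> _.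
  by exists O; split=> // A' AA' _; apply: fil_mono fil _ _ _ AA' TO.
have [->|/seq_max[m mE mmax]] := eqVneq E [::].
  by exists O; split=> // A' AA' _; apply: fil_mono fil _ _ _ AA' TO.
move=> En ED; pose E' := [seq c <- E | c != m].
have [||P [PO P0 HP TP]] := IHn E'.
- rewrite -ltnS; apply: leq_trans En; rewrite size_filter.
  rewrite -(count_predC (pred1 m) E) -[ltnLHS]add0n ltn_add2r.
  by rewrite -has_count has_pred1.
- by move=> c; rewrite mem_filter => /andP[_ /ED].
have mD := ED m mE.
have [|P' [P'P P'0 TP' HP']] := step m P mD _ P0 PO.
  apply: TP; first exact: AD.
  move=> c; rewrite mem_filter => /andP[cm cE]; apply: hiD => //; first exact: ED.
  by have [//|cmE|mc] := swo_total wo c m; [rewrite cmE eqxx in cm|case: (mmax c)].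
exists P'; split=> //.
- exact: subset_trans P'P PO.
- move=> c cE; have [->//|cm] := eqVneq c m.
  by apply: Hmono P'P _; apply: HP; rewrite mem_filter cm.
- by move=> A' _ /(_ m mE) hA; apply: fil_mono fil _ _ _ hA TP'.
Qed.

(** Choose for each k a cell over finitely many smaller indices in which U k is
dense, and press down. *)
Lemma regular_homogeneous (I : set K) x0 : regular lt I -> I x0 ->
  exists t Q S, [/\ [set` t] `<=` I, B t Q, S `<=` I, unbounded lt I S &
    forall k, S k -> [/\ x0 ≺ k, [set` t] `<=` below k &
      dense_in (T (below k)) (U k) Q]].
Proof.
move=> rI Ix0.
have /choice[s /choice[q sq]] k :
    exists s Q, [/\ [set` s] `<=` below k, B s Q & dense_in (T (below k)) (U k) Q].
  by have [TU U0] := fil_family fil k; apply: (fil_dense fil) => //;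
    apply: fil_open fil _ _ TU.
have sk k z : z \in s k -> z ≺ k by have [h _ _] := sq k => /h.
have [t [Q tQ]] := pressing_down (s := s) (q := q) wo rI Ix0 (fun k _ => sk k)
  (fil_countable fil) (fun k _ => let: And3 _ b _ := sq k in b).
have [k0 [Ik0 [sk0 qk0] _]] := tQ x0 Ix0.
exists t, Q, [set k | [/\ I k, x0 ≺ k, s k = t & q k = Q]]; split.
- by move=> z /=; rewrite -sk0 => /sk zk0; apply: (reg_initial rI) zk0.
- by have [_ + _] := sq k0; rewrite sk0 qk0.
- by move=> k [].
- move=> x Ix; have [y [Iy xy x0y]] := seq_bounded2 (reg_seq rI) Ix Ix0.
  have [k [Ik [skt qkt] yk]] := tQ y Iy.
  exists k; split=> //; last exact: swo_trans wo _ _ _ xy yk.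
  by split=> //; apply: swo_trans wo _ _ _ x0y yk.
- by move=> k [Ik xk <- <-]; have [h _ dk] := sq k.
Qed.

(** [amalgamation] with a single set U k to meet at each k. By density, U k
meets any nonempty subset of Q that is open for indices below k. *)
Lemma homogeneous_meet (A : set K) (S : set K) (Q O : set X) (ks : seq K) :
  [set` ks] `<=` S ->
  (forall k, S k -> A `<=` below k /\ dense_in (T (below k)) (U k) Q) ->
  T A O -> O !=set0 -> O `<=` Q ->
  exists P, [/\ P `<=` O, P !=set0, forall k, k \in ks -> P `<=` U k &
    forall A', A `<=` A' -> (forall k, k \in ks -> below k `|` [set k] `<=` A') ->
    T A' P].
Proof.
move=> ksS SQ TO O0 OQ; apply: amalgamation => //.
- by move=> k /ksS/SQ[].
- move=> c d _ _ cd z [zc|->//]; exact: swo_trans wo _ _ _ zc cd.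
- by move=> c P P' P'P PU; apply: subset_trans P'P PU.
move=> c P /ksS/SQ[_ dc] TP P0 PO; exists (P `&` U c); split.
- by move=> x [].
- by apply: dc => //; apply: subset_trans PO OQ.
- apply: fil_setI fil _ _ _ _ _; first by apply: fil_mono fil _ _ _ _ TP; left.
  by apply: fil_mono fil _ _ _ _ (fil_family fil c).1; right.
- by move=> x [].
Qed.

(** The common cell Q of [regular_homogeneous] may involve indices between c
and y. For that reason O is chosen a step lower: Q is itself dense in a cell O
for indices below c. A set P inside O that is open for indices below c first
meets Q, and then the U k. *)
Lemma homogeneous_chunk c y : regular lt (below y) -> c ≺ y ->
  exists s O S, [/\ [set` s] `<=` below c, B s O, below y #<= S,
    forall k, S k -> c ≺ k /\ k ≺ y &
    forall (ks : seq K) P,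
      [set` ks] `<=` S -> T (below c) P -> P !=set0 -> P `<=` O ->
      exists P', [/\ P' `<=` P, P' !=set0, T (below y) P' &
        forall k, k \in ks -> P' `<=` U k]].
Proof.
move=> ry cy; have [t [Q [S [ty BQ Sy Sunb SQ]]]] := regular_homogeneous ry cy.
have [TQ Q0] := fil_base fil BQ.
have [s [O [sc BO dO]]] := fil_dense fil (below c) (fil_open fil TQ) Q0.
exists s, O, S; split=> //.
- exact: (unbounded_card_ge wo ry Sy Sunb).
- by move=> k Sk; have [ck _ _] := SQ k Sk; split=> //; apply: Sy.
move=> ks P ksS TP P0 PO.
have [||||P' [P'PQ P'0 P'U TP']] :=
  @homogeneous_meet (below c `|` [set` t]) S Q (P `&` Q) ks ksS.
- move=> k Sk; have [ck tk dk] := SQ k Sk; split=> // z [zc|/tk//].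
  exact: swo_trans wo _ _ _ zc ck.
- by apply: fil_setI fil _ _ _ _ _; [apply: fil_mono fil _ _ _ _ TP|
    apply: fil_mono fil _ _ _ _ TQ]; [left|right].
- exact: dO.
- by move=> x [].
exists P'; split=> //; first by move=> x /P'PQ[].
apply: TP'; first by move=> z [zc|/ty//]; exact: swo_trans wo _ _ _ zc cy.
move=> k /ksS/Sy ky z [zk|->//]; exact: swo_trans wo _ _ _ zk ky.
Qed.

End Amalgamation.

Lemma regular_centered (G : paratopologicalGroupType) (K : choiceType)
    (lt : K -> K -> Prop) (I : set K) x0 (U : K -> set G) :
  totally_bounded G -> strict_wo lt -> regular lt I -> I x0 ->
  (forall k, open (U k) /\ U k !=set0) ->
  exists S, [/\ S `<=` I, unbounded lt I S &
    forall ks : seq K, [set` ks] `<=` S -> exists x, forall k, k \in ks -> U k x].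
Proof.
move=> hG wo rI Ix0 oU; have [T [B [U' [fil U'U]]]] := filtration_exists hG oU.
have [t [Q [S [tI BQ SI Sunb SQ]]]] := regular_homogeneous wo fil rI Ix0.
exists S; split=> // ks ksS; have [TQ Q0] := fil_base fil BQ.
have SQ' k : S k -> [set` t] `<=` below lt k /\ dense_in (T (below lt k)) (U' k) Q.
  by move=> /SQ[].
have [P [_ [x Px] PU _]] := homogeneous_meet wo fil ksS SQ' TQ Q0 (fun x => id).
by exists x => k kks; apply: U'U; apply: PU Px.
Qed.

(** * Successor segments and singular cardinals *)

Section Successor.
Variables (K : choiceType) (lt : K -> K -> Prop).
Hypothesis wo : strict_wo lt.
Local Notation "x ≺ y" := (lt x y) (at level 70).
Local Notation below := (below lt).

Lemma below_initial y : initial lt (below y).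
Proof. by move=> x z zy xz; apply: swo_trans wo _ _ _ xz zy. Qed.

Lemma card_le_below_nlt x y : ~ y ≺ x -> below x #<= below y.
Proof. by move=> yx; apply: subset_card_le; apply: swo_nlt_sub. Qed.

(** The segment below y has the least cardinality greater than that of the
segment below x. If a family of at most the latter size were cofinal in it, then
it would be covered by that many sets of at most that size, hence be no larger
than the square of the segment below x. *)
Lemma regular_succ x y : infinite_set (below x) -> ~ (below y #<= below x) ->
  (forall z, z ≺ y -> below z #<= below x) -> regular lt (below y).
Proof.
move=> ix nyx yx.
have nolast z : z ≺ y -> exists2 u, u ≺ y & z ≺ u.
  move=> zy; apply: contrapT => nu; apply: nyx.
  apply: card_le_trans (infinite_card_le_setU1 z ix (yx z zy)).
  apply: subset_card_le => v vy; have [vz|->|zv] := swo_total wo v z.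
  - by left.
  - by right.
  - by case: nu; exists v.
have bounded J (P : set J) (g : J -> K) : P #<= below x ->
    (forall j, P j -> g j ≺ y) -> exists2 u, u ≺ y & forall j, P j -> g j ≺ u.
  move=> Px gy; apply: contrapT => nu; apply: nyx.
  apply: card_le_trans (card_square_below wo ix).
  apply: (@card_le_cover _ _ _ _ P (fun j => below (g j)) _ Px).
    by move=> j Pj; apply/yx/gy.
  move=> v vy; apply: contrapT => nv; apply: nu.
  have [u uy vu] := nolast v vy; exists u => // j Pj.
  apply: swo_nlt_trans wo _ _ _ _ vu => vg.
  by apply: nv; exists j.
split; first exact: below_initial.
- by move=> b g bI gI; apply: (bounded _ (below b) g) => //; apply: yx.
- move=> g gI; have [||u uy gu] := bounded _ [set: nat] g.
  + exact/infiniteP.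
  + by move=> n _; apply: gI.
  + by exists u => // n; apply: gu.
Qed.

Lemma seq_bounded_infinite (I : set K) x0 :
  initial lt I -> seq_bounded lt I -> I x0 -> exists2 w, I w & infinite_set (below w).
Proof.
move=> iI sI Ix0.
have [a [d [ladd _]]] := ladder wo iI sI Ix0 (f := id) (fun _ => id).
have [Ia [Id [ad _]]] := ladd.
exists d => // /finite_seqP[s sE].
have [|n sn] := ladder_limit_seq wo (s := s) ladd.
  by move=> z zs; have : [set` s] z by []; rewrite -sE.
apply: (swo_irr wo (x := a n)); apply: sn.
by have : below d (a n) by []; rewrite sE.
Qed.

End Successor.

Section Singular.
Variables (K : choiceType) (lt : K -> K -> Prop).
Hypothesis wo : strict_wo lt.
Local Notation "x ≺ y" := (lt x y) (at level 70).
Local Notation below := (below lt).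
Hypothesis sK : seq_bounded lt [set: K].
Hypothesis smallK : forall x, ~ ([set: K] #<= below x).

Lemma above x y : exists u, x ≺ u /\ y ≺ u.
Proof.
have [u [_ xu yu]] := seq_bounded2 sK (x := x) (y := y) Logic.I Logic.I.
by exists u.
Qed.

(** The segment below a has the cofinality of K as order type: a is minimal such
that some f on the elements below a is unbounded in K. A shorter family cofinal
in that segment would give, through bounds of f along it, a shorter unbounded
family in K. *)
Lemma singular_cofinal : ~ regular lt [set: K] ->
  exists a f, [/\ regular lt (below a), forall u, exists2 x, x ≺ a & u ≺ f x &
    forall b (g : K -> K), b ≺ a -> exists u, forall x, x ≺ b -> g x ≺ u].
Proof.
move=> nreg; pose bad := [set b | exists g : K -> K,
  ~ exists u, forall x, x ≺ b -> g x ≺ u].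
have [|a [f fP] amin] := swo_min wo (A := bad).
  apply: contrapT => nbad; apply: nreg; split=> // b g _ _.
  apply: contrapT => nu; apply: nbad; exists b, g => -[u gu].
  by apply: nu; exists u.
have fu u : exists2 x, x ≺ a & u ≺ f x.
  have [v [uv _]] := above u u.
  apply: contrapT => nx; apply: fP; exists v => x xa.
  apply: swo_nlt_trans wo _ _ _ _ uv => ufx.
  by apply: nx; exists x.
have ab b (g : K -> K) : b ≺ a -> exists u, forall x, x ≺ b -> g x ≺ u.
  by move=> ba; apply: contrapT => ng; apply: (amin b) => //; exists g.
exists a, f; split=> //.
have bounded J (P : set J) (g : J -> K) :
    (forall v : J -> K, exists u, forall j, P j -> v j ≺ u) ->
    (forall j, P j -> g j ≺ a) -> exists2 u, u ≺ a & forall j, P j -> g j ≺ u.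
  move=> bP ga; apply: contrapT => nu.
  (* v j bounds f up to and including g j, so a bound of v would bound f if g
     were cofinal. *)
  have /choice[v vP] j : exists v, P j -> forall x, x ≺ g j \/ x = g j -> f x ≺ v.
    have [Pj|nPj] := pselect (P j); last by exists a.
    have [u gu] := ab _ f (ga j Pj); have [v [uv fv]] := above u (f (g j)).
    exists v => _ x [/gu fxu|->//]; exact: swo_trans wo _ _ _ fxu uv.
  have [u vu] := bP v; have [x xa ux] := fu u.
  apply: nu; exists x => // j Pj.
  have [//|gx|xg] := swo_total wo (g j) x.
    case: (swo_irr wo (x := u)); apply: swo_trans wo _ _ _ ux _.
    by apply: swo_trans wo _ _ _ _ (vu j Pj); apply: vP => //; right.
  case: (swo_irr wo (x := u)); apply: swo_trans wo _ _ _ ux _.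
  by apply: swo_trans wo _ _ _ _ (vu j Pj); apply: vP => //; left.
split; first exact: below_initial.
- move=> b g ba gI; apply: (bounded _ (below b)) => // v.
  exact: ab.
- move=> g gI; have [||u ua gu] := bounded _ [set: nat] g.
  + by move=> v; have [//|u _ vu] := sK (g := v); exists u => j _.
  + by move=> n _; apply: gI.
  + by exists u => // n; apply: gu.
Qed.

(** The values of y mark the successor cardinals. They stay inside K: if all
segments of K were of size at most that of the one below x, then K, being a
union of few of them, would be no larger than the square of a segment. *)
Lemma successor_fun : ~ regular lt [set: K] -> exists y : K -> K,
  [/\ forall x, x ≺ y x, forall x x', ~ x' ≺ x -> ~ y x' ≺ y x &
      forall x, infinite_set (below x) -> regular lt (below (y x))].
Proof.
move=> nreg; have [a [f [_ fu _]]] := singular_cofinal nreg.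
have [//|w _ iw] := seq_bounded_infinite wo _ sK (I : [set: K] a).
have ex_y x : exists y, ~ (below y #<= below x).
  apply: contrapT => ny; have {}ny y : below y #<= below x.
    by apply: contrapT => nyx; apply: ny; exists y.
  have [m [mx mw _]] := swo_max wo x w.
  have bm y : below y #<= below m.
    exact: card_le_trans (ny y) (card_le_below_nlt wo mx).
  have im : infinite_set (below m).
    by move=> /(card_le_finite (card_le_below_nlt wo mw)).
  apply: (smallK (x := m)); apply: card_le_trans (card_square_below wo im).
  apply: (@card_le_cover _ _ _ _ (below a) (fun x => below (f x))) => //.
  by move=> u _; have [z za uz] := fu u; exists z.
have /choice[y yP] x : exists y, ~ (below y #<= below x) /\
    forall z, z ≺ y -> below z #<= below x.
  have [y yx ymin] := swo_min wo (ex_y x).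
  by exists y; split=> // z zy; apply: contrapT => nz; apply: (ymin z).
exists y; split.
- move=> x; apply: contrapT => nxy; apply: (yP x).1.
  exact: card_le_below_nlt.
- move=> x x' xx' /(yP x).2 h; apply: (yP x').1; apply: card_le_trans h _.
  exact: card_le_below_nlt.
- by move=> x ix; apply: regular_succ wo _ _ ix _ _; case: (yP x).
Qed.

Variables (G : paratopologicalGroupType) (U : K -> set G).
Hypothesis hG : totally_bounded G.
Hypothesis oU : forall k, open (U k) /\ U k !=set0.

(** The families S c live between c and y c, for c closed under y, hence are
disjoint for distinct c. Once the cells O (e i) have been made centered and
dependent only on indices below j, [amalgamation] runs through the e i: the
set obtained on arriving at e i is open for indices below e i and contained in
O (e i), so it can be shrunk to meet the required members of S (e i). *)
Lemma singular_centered : ~ regular lt [set: K] ->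
  exists2 S : set K, [set: K] #<= S &
    forall ks : seq K, [set` ks] `<=` S -> exists x, forall k, k \in ks -> U k x.
Proof.
move=> nreg; have [a [f [ra fu ab]]] := singular_cofinal nreg.
have [//|w _ iw] := seq_bounded_infinite wo _ sK (Logic.I : [set: K] a).
have [y [xy ymono yreg]] := successor_fun nreg.
have [T [B [U' [fil U'U]]]] := filtration_exists hG oU.
pose C := [set c | ~ c ≺ w /\ forall x, x ≺ c -> y x ≺ c].
have /choice[s /choice[O /choice[S CP]]] c : exists s O S, C c ->
    [/\ [set` s] `<=` below c, B s O, below (y c) #<= S,
    forall k, S k -> c ≺ k /\ k ≺ y c &
    forall (ks : seq K) P,
      [set` ks] `<=` S -> T (below c) P -> P !=set0 -> P `<=` O ->
      exists P', [/\ P' `<=` P, P' !=set0, T (below (y c)) P' &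
        forall k, k \in ks -> P' `<=` U' k]].
  have [Cc|nCc] := pselect (C c); last by exists [::], setT, setT.
  have ic : infinite_set (below c).
    by move=> /(card_le_finite (card_le_below_nlt wo Cc.1)).
  have [s [O [S h]]] := homogeneous_chunk wo fil (yreg c ic) (xy c).
  by exists s, O, S.
have [j _ Cj] : exists2 j, [set: K] j &
    unbounded lt [set: K] [set c | C c /\ forall z, z \in s c -> z ≺ j].
  apply: (reflection wo (x0 := w) (f := y)) => //.
    move=> a' d [aI [_ [ad da]]] a0 ya; split.
      by rewrite -a0 => /(swo_trans wo (ad 0%N)); exact: swo_irr.
    move=> x /da[n xn]; apply: swo_trans wo _ _ _ _ (ad n.+1).
    apply: swo_nlt_trans wo _ _ _ _ (ya n); apply: ymono => ax.
    by apply: (swo_irr wo (x := x)); apply: swo_trans wo _ _ _ xn ax.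
  by move=> k _ Ck z; have [h _ _ _ _] := CP k Ck => /h.
(* f need not be monotone, so e i is chosen above the values of f
   on all the elements below i;
   then e is cofinal on every unbounded set of i's. *)
have /choice[v vP] i : exists v, i ≺ a -> forall x, x ≺ i -> f x ≺ v.
  have [ia|nia] := pselect (i ≺ a); last by exists a.
  by have [v fv] := ab i f ia; exists v.
have /choice[e eP] i : exists c,
    [/\ C c, forall z, z \in s c -> z ≺ j, j ≺ c & v i ≺ c].
  have [u [ju vu]] := above j (v i); have [c [_ [Cc sc] uc]] := Cj u Logic.I.
  by exists c; split=> //; apply: swo_trans wo _ _ _ _ uc.
have TO i : T (below j) (O (e i)) /\ O (e i) !=set0.
  have [Ce sj _ _] := eP i; have [_ BO _ _ _] := CP _ Ce.
  have [TO O0] := fil_base fil BO; split=> //.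
  by apply: fil_mono fil _ _ _ _ TO.
have [x0 x0a _] := fu a.
have [L [La Lunb Lcent]] := regular_centered (U := O \o e) hG wo ra x0a
  (fun i => conj (fil_open fil (TO i).1) (TO i).2).
have /choice[c cP] x : exists i, L i /\ x ≺ e i.
  have [i ia xfi] := fu x; have [i' [i'a Li' ii']] := Lunb i ia.
  exists i'; split=> //; have [_ _ _ vi] := eP i'.
  apply: swo_trans wo _ _ _ xfi _; apply: swo_trans wo _ _ _ _ vi.
  exact: vP.
have Cdisj c1 c2 k : C c1 -> C c2 -> S c1 k -> S c2 k -> ~ c1 ≺ c2.
  move=> C1 C2 S1 S2 c12; have [_ _ _ /(_ k S1)[_ ky] _] := CP c1 C1.
  have [_ _ _ /(_ k S2)[ck _] _] := CP c2 C2.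
  apply: (swo_irr wo (x := k)); apply: swo_trans wo _ _ _ ky _.
  by apply: swo_trans wo _ _ _ _ ck; apply: C2.2.
have Ce i : C (e i) by have [] := eP i.
have /choice[r rP] q : exists r : K -> K -> Prop, C q ->
    (forall z, below (y q) z -> exists2 k, S q k & r z k) /\
    (forall z z' k, below (y q) z -> below (y q) z' -> r z k -> r z' k -> z = z').
  have [Cq|nCq] := pselect (C q); last by exists (fun _ _ => True).
  by have [_ _ /card_le_relP[r rP] _ _] := CP q Cq; exists r.
(* Send x to an element of S (e (c x)), where e (c x) is above x; there is
   room for it since S (e (c x)) is as large as the segment below
   y (e (c x)). *)
exists [set k | exists2 i, L i & S (e i) k].
  have cy x : below (y (e (c x))) x.
    by apply: swo_trans wo _ _ _ (cP x).2 (xy _).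
  apply/card_le_relP; exists (fun x k => r (e (c x)) x k /\ S (e (c x)) k); split.
    move=> x _; have [k Sk rk] := (rP _ (Ce (c x))).1 x (cy x).
    by exists k => //; exists (c x) => //; have [] := cP x.
  move=> x x' k _ _ [rx Sx] [rx' Sx'].
  have ee : e (c x) = e (c x').
    have [h|//|h] := swo_total wo (e (c x)) (e (c x')).
      by case: (Cdisj _ _ _ (Ce _) (Ce _) Sx Sx').
    by case: (Cdisj _ _ _ (Ce _) (Ce _) Sx' Sx).
  apply: (rP _ (Ce (c x))).2 rx _ => //; first by rewrite /= ee; apply: cy.
  by rewrite ee.
move=> ks ksS; have /choice[i iP] k : exists i, k \in ks -> L i /\ S (e i) k.
  have [kks|nk] := boolP (k \in ks); last by exists a.
  by have [i Li Si] := ksS k kks; exists i.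
have [|x Ox] := Lcent [seq i k | k <- ks].
  by move=> q /= /mapP[k /iP[Lk _] ->].
have [||q /mapP[k _ ->]|c1 c2 _ /mapP[k _ ->] c12 z zc|q P P' P'P PU k kks eq|
    c1 P /mapP[k kks ->] TP P0 PO|P [_ [p Pp] PU _]] :=
  @amalgamation _ _ lt T B U' wo fil [seq e (i k) | k <- ks] (below j)
    (fun q => below (y q))
    (fun q P => forall k, k \in ks -> e (i k) = q -> P `<=` U' k)
    [set x | forall k, k \in ks -> O (e (i k)) x].
- by apply: (fil_seqI fil (F := O \o e \o i)) => k _; have [] := TO (i k).
- by exists x => k kks; apply: Ox; apply: map_f.
- have [_ _ jc _] := eP (i k).
  by move=> z zj; apply: swo_trans wo _ _ _ zj jc.
- by apply: swo_trans wo _ _ _ zc _; apply: (Ce (i k)).2.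
- exact: subset_trans P'P (PU k kks eq).
- have [_ _ _ _ hit] := CP _ (Ce (i k)).
  have [||P' [P'P P'0 TP' P'U]] :=
    hit [seq k' <- ks | e (i k') == e (i k)] P _ TP P0.
  + by move=> k' /=; rewrite mem_filter => /andP[/eqP <- /iP[]].
  + by move=> z /PO; apply.
  exists P'; split=> // k' k'ks kk.
  by apply: P'U; rewrite mem_filter kk eqxx.
exists p => k kks; apply: U'U; apply: PU Pp => //.
exact: map_f.
Qed.

Lemma big_centered :
  exists2 S : set K, [set: K] #<= S &
    forall ks : seq K, [set` ks] `<=` S -> exists x, forall k, k \in ks -> U k x.
Proof.
have [reg|] := pselect (regular lt [set: K]); last exact: singular_centered.
have [k0|nK] := pselect (exists k : K, True); last first.
  exists set0; first by apply/card_le_relP; exists (fun _ _ => True); split=> x;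
    case: nK; exists x.
  by move=> ks _; exists 1%g => k; case: nK; exists k.
have [x0 _] := k0.
have [S [_ Sunb Scent]] := regular_centered hG wo reg (Logic.I : [set: K] x0) oU.
by exists S => //; apply: (unbounded_card_ge wo reg _ Sunb).
Qed.

End Singular.

(** * Cellularity and precalibers *)

(** In a well-ordering of an uncountable K, the elements with countably many
predecessors form a regular segment, of the type of the first uncountable
ordinal. There two sets of the family would meet. *)
Lemma disjoint_family_countable (G : paratopologicalGroupType) (K : Type)
    (U : K -> set G) :
  totally_bounded G -> (forall k, open (U k) /\ U k !=set0) ->
  (forall k k', U k `&` U k' !=set0 -> k = k') -> countable [set: K].
Proof.
move=> hG; elim/Pchoice: K => K in U *; move=> oU dU; apply: contrapT => unc.
have [R /well_order_strict wo] := wochoice.well_ordering_principle K.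
set lt := (fun x y : K => _) in wo.
pose I := [set x | countable (below lt x)].
have uncI : ~ countable I.
  move=> cI; have [x nIx] : ~` I !=set0.
    apply: contrapT => nI; apply: unc; apply: sub_countable cI.
    by apply: subset_card_le => x _; apply: contrapT => nIx; apply: nI; exists x.
  have [m nIm mmin] := swo_min wo (ex_intro (~` I) x nIx).
  apply: nIm; apply: sub_countable cI; apply: subset_card_le => z zm.
  by apply: contrapT => nIz; apply: (mmin z).
have bounded J (P : set J) (g : J -> K) : countable P ->
    (forall j, P j -> I (g j)) -> exists2 u, I u & forall j, P j -> lt (g j) u.
  move=> cP gI; apply: contrapT => nu; apply: uncI.
  have cU : countable (\bigcup_(j in P) (below lt (g j) `|` [set g j])).
    apply: bigcup_countable => // j Pj.
    by apply: infinite_card_le_setU1; [exact: infinite_nat|exact: gI].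
  apply: sub_countable cU; apply: subset_card_le => u Iu.
  apply: contrapT => nU; apply: nu; exists u => // j Pj.
  have [//|gu|ug] := swo_total wo (g j) u; case: nU; exists j => //; first by right.
  by left.
have reg : regular lt I.
  split.
  - move=> x y Iy xy; apply: sub_countable Iy; apply: subset_card_le.
    by move=> z zx; apply: swo_trans wo _ _ _ zx xy.
  - by move=> b g Ib gI; apply: (bounded _ (below lt b)).
  - move=> g gI; have [|u Iu gu] := bounded _ [set: nat] g _ (fun n _ => gI n).
      exact: countableP.
    by exists u => // n; apply: gu.
have [x0 Ix0] : I !=set0.
  by apply: contrapT => I0; apply: uncI; rewrite (_ : I = set0) //; apply/eqP;
    apply: contrapT => /negP/set0P.
have [S [SI Sunb Scent]] := regular_centered hG wo reg Ix0 oU.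
have [k [Ik Sk _]] := Sunb x0 Ix0; have [k' [_ Sk' kk']] := Sunb k Ik.
have [|x Ux] := Scent [:: k; k'].
  by move=> z /=; rewrite !inE => /orP[]/eqP->.
apply: (swo_irr wo (x := k)); rewrite {2}(dU k k') //.
by exists x; split; apply: Ux; rewrite !inE eqxx ?orbT.
Qed.

Theorem corollary3 (G : paratopologicalGroupType) (hG : totally_bounded G) :
  countably_cellular G /\
  (forall (K : Type) (R : rel K),
     is_cardinal R -> uncountable_cofinality R -> precaliber K G).
Proof.
split.
  move=> W oW triv; rewrite -(eq_countable (card_setT W)).
  apply: (@disjoint_family_countable G W (fun A => val A) hG).
    by move=> A; apply: oW; apply: set_valP.
  move=> A A' AA'; apply: val_inj; apply: triv AA'; exact: set_valP.
move=> K; elim/Pchoice: K => K R [/well_order_strict wo smallK] cofK W oW WK.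
have sK : seq_bounded (fun x y => ~~ R y x) [set: K].
  move=> g _; apply: contrapT => nu; apply: (cofK (range g)); last first.
    exact: card_le_trans (card_image_le _ _) (countableP _).
  move=> u; apply: contrapT => ng; apply: nu; exists u => // n; apply/negP => ug.
  by apply: ng; exists (g n) => //; exists n.
have [/card_le_relP[r [rW rI]] _] : [set: K] #<= W /\ W #<= [set: K].
  by move: WK => /card_eqPle[].
have /choice[phi phiP] k : exists A, W A /\ r k A.
  by have [A] := rW k Logic.I; exists A.
have phiI k k' : phi k = phi k' -> k = k'.
  move=> kk; apply: (rI _ _ (phi k)) => //; first by have [] := phiP k.
  by rewrite kk; have [] := phiP k'.
have [||S KS Scent] := big_centered (U := phi) wo sK _ hG.
- by move=> x; apply/negP; apply: smallK.
- by move=> k; apply: oW; have [] := phiP k.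
exists (phi @` S); split.
- by move=> _ [k _ <-]; have [] := phiP k.
- have phiS : phi @` S #= S by apply: inj_card_eq => k k' _ _; apply: phiI.
  apply: card_eq_trans phiS _; apply/card_eqPle; split=> //.
  exact: card_leT.
- move=> F finF FV.
  have : finite_set (phi @^-1` F).
    by apply: finite_preimage finF => k k' _ _; apply: phiI.
  move=> /finite_seqP[ks ksE].
  have [|x Ux] := Scent ks.
    move=> k; rewrite -ksE => /FV[k' Sk' /phiI <-] //.
  exists x => A FA; have [k Sk kA] := FV A FA.
  by rewrite -kA; apply: Ux; have : [set` ks] k by rewrite -ksE /= kA.
Qed.
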